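(* Let $n\ge1$ be an integer and $0\le\alpha<1$. Call a function $\hat q:\{0,1,\dots,n\}\to\mathbb R$ a valid bound if $$P\big(\bar q\ge\hat q(n\bar T)\big)\ \ge\ 1-\alpha$$ holds for every family of independent Bernoulli random variables $T_1,\dots,T_n\in\{0,1\}$ with arbitrary parameters $P(T_i=1)=q_i\in[0,1]$, where $\bar q=\frac1n\sum_{i=1}^nq_i$ and $n\bar T=\sum_{i=1}^nT_i$. Then the statistic $k\mapsto\hat q^f_\alpha(k,n)$ defined in the context is the largest monotonically increasing valid bound: it is monotonically increasing in $k$, it is a valid bound, and for every monotonically increasing valid bound $\hat q'$ one has $\hat q^f_\alpha(k,n)\ge\hat q'(k)$ for all $0\le k\le n$.
   Context: ''Monotonically increasing'' is meant in the weak sense: $\hat q(k)\le\hat q(k+1)$ for all $0\le k\le n-1$. For $a,b>0$ and $x\in[0,1]$, $I_x(a,b)=\frac{\Gamma(a+b)}{\Gamma(a)\Gamma(b)}\int_0^x t^{a-1}(1-t)^{b-1}\,dt$ is the regularized incomplete Beta function, and for $\alpha\in[0,1]$, $I^{-1}_\alpha(a,b)$ is its inverse in $x$, i.e. the unique $x\in[0,1]$ with $I_x(a,b)=\alpha$. For integers $0\le c\le n-1$, $0\le s\le c$ and $\alpha\in[0,1]$ let $$S_n(c,\alpha,s)=\frac{s+(n-s)\,I^{-1}_{1-\alpha}(c-s+1,\,n-c)}{n},\qquad S_n(c,\alpha)=\max_{0\le s\le c,\ s\in\mathbb Z}S_n(c,\alpha,s).$$ For $0\le d\le n-1$ let $\alpha^\dagger=\alpha^\dagger(d,n)=I_{d/n}(d+1,n-d)$.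 For $-1\le d\le n-1$ and $\alpha\in[0,1]$ define $$\tilde f_\alpha(d,n)=\begin{cases}0 & d=-1\\ 1-S_n(n-d-1,\alpha) & d\ge0,\ \alpha^\dagger<\alpha\le1\\ I^{-1}_\alpha(d+1,n-d) & d\ge0,\ 0\le\alpha\le\alpha^\dagger,\end{cases}$$ and $\hat q^f_\alpha(k,n)=\tilde f_\alpha(k-1,n)$ for $k\in\{0,1,\dots,n\}$. *)

(* Defs.v *)
From HB Require Import structures.
From mathcomp Require Import all_boot all_order all_algebra.
From mathcomp Require Import all_classical all_reals all_analysis.
Set Implicit Arguments.
Unset Strict Implicit.
Unset Printing Implicit Defensive.
Import Order.TTheory GRing.Theory Num.Theory.
Import numFieldNormedType.Exports.
Local Open Scope classical_set_scope.
Local Open Scope ring_scope.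

Definition Gamma (R : realType) (a : R) : R :=
  \int[@lebesgue_measure R]_(t in `]0, +oo[) (t `^ (a - 1) * expR (- t)).

Definition inc_beta (R : realType) (a b x : R) : R :=
  Gamma (a + b) / (Gamma a * Gamma b) *
  \int[@lebesgue_measure R]_(t in `[0, x]) (t `^ (a - 1) * (1 - t) `^ (b - 1)).

(* [xget] picks an element of the set, which is a singleton for 0 < a, 0 < b
   and 0 <= alpha <= 1; the default value 0 is irrelevant. *)
Definition inc_beta_inv (R : realType) (a b alpha : R) : R :=
  xget 0 [set x : R | 0 <= x <= 1 /\ inc_beta a b x = alpha].

(* Natural-number subtractions below are used only in the range where they are
   exact: s <= c < n for [Sn] and [Snmax], 0 <= d < n for [ftilde]. *)
Definition Sn (R : realType) (n c : nat) (alpha : R) (s : nat) : R :=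
  (s%:R + (n - s)%:R * inc_beta_inv (c - s + 1)%:R (n - c)%:R (1 - alpha))
    / n%:R.

(* The neutral value of the iterated maximum is the term s = 0, so that no
   extraneous value enters the maximum. *)
Definition Snmax (R : realType) (n c : nat) (alpha : R) : R :=
  \big[Num.max/Sn n c alpha 0]_(0 <= s < c.+1) Sn n c alpha s.

Definition alpha_dagger (R : realType) (d n : nat) : R :=
  inc_beta (d + 1)%:R (n - d)%:R (d%:R / n%:R).

(* The only negative argument that occurs is d = -1. *)
Definition ftilde (R : realType) (alpha : R) (d : int) (n : nat) : R :=
  match d with
  | Negz _ => 0
  | Posz d =>
      if alpha_dagger R d n < alpha then 1 - Snmax n (n - d - 1) alpha
      else inc_beta_inv (d + 1)%:R (n - d)%:R alpha
  end.

Definition qhatf (R : realType) (alpha : R) (n : nat) (k : 'I_n.+1) : R :=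
  ftilde alpha (k%:Z - 1) n.

Definition monotone_bound (R : realType) (n : nat) (qhat : 'I_n.+1 -> R) :=
  forall k l : 'I_n.+1, l = k.+1 :> nat -> qhat k <= qhat l.

Definition mutually_independent d d' (Omega : measurableType d)
    (E : measurableType d') (R : realType) (P : probability Omega R)
    (I : finType) (X : I -> {RV P >-> E}) : Prop :=
  forall (J : {set I}) (B : I -> set E), (forall i, measurable (B i)) ->
    P (\bigcap_(i in [set` J]) (X i @^-1` B i)) =
    (\prod_(i in J) P (X i @^-1` B i))%E.
Arguments mutually_independent {d d' Omega E R} P {I} X.

(* {0,1}-valued variables are bool-valued, with true standing for 1. *)
Definition bernoulli_family d (Omega : measurableType d) (R : realType)
    (P : probability Omega R) (n : nat) (q : 'I_n -> R)
    (T : 'I_n -> {RV P >-> bool}) : Prop :=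
  mutually_independent P T /\
  forall i, P (T i @^-1` [set true]) = (q i)%:E.
Arguments bernoulli_family {d Omega R} P {n} q T.

(* [inord] is applied to a number which is at most n, hence is exact. *)
Definition success_count d (Omega : measurableType d) (R : realType)
    (P : probability Omega R) (n : nat) (T : 'I_n -> {RV P >-> bool})
    (w : Omega) : 'I_n.+1 :=
  inord (\sum_(i < n) (T i w : nat))%N.
Arguments success_count {d Omega R} P {n} T w.

Definition mean (R : realType) (n : nat) (q : 'I_n -> R) : R :=
  n%:R^-1 * \sum_(i < n) q i.

Definition valid_bound (R : realType) (n : nat) (alpha : R)
    (qhat : 'I_n.+1 -> R) : Prop :=
  forall (d : measure_display) (Omega : measurableType d)
    (P : probability Omega R) (q : 'I_n -> R) (T : 'I_n -> {RV P >-> bool}),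
    (forall i, 0 <= q i <= 1) -> bernoulli_family P q T ->
    ((1 - alpha)%:E <= P [set w | (qhat (success_count P T w) <= mean q)%R])%E.

(* Main.v *)
(* Among monotone bounds, validity says that P(S >= k) <= alpha whenever the
   mean success probability is below q(k); hence the largest monotone valid
   bound at k is the infimum of the means of the vectors q with
   P_q(S >= k) > alpha.  This infimum is computed with Hoeffding's extremal
   argument.  For a fixed mean, P_q(S < k) is affine in the product q_i q_j once
   the other coordinates and q_i + q_j are fixed.  At a minimiser which moreover
   minimises the sum of squares, equalising q_i <> q_j must strictly increase
   P_q(S < k), so spreading them apart would decrease it: all coordinates are
   0, 1 or a common value a.  Unimodality of the binomial weights then excludes
   the value 1 when n times the mean is below k, and the value 0 when it is at
   most k - 1.  What remains are the binomial tails, which are regularized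
   incomplete Beta functions. *)
From HB Require Import structures.
Require Import Defs.
From mathcomp Require Import all_boot all_order all_algebra.
From mathcomp Require Import all_classical all_reals all_analysis.
From mathcomp Require Import measurable_realfun zify ring lra.
Set Implicit Arguments.
Unset Strict Implicit.
Unset Printing Implicit Defensive.
Import Order.TTheory GRing.Theory Num.Theory.
Import numFieldNormedType.Exports.
Local Open Scope classical_set_scope.
Local Open Scope ring_scope.

(** * Generating polynomials *)

Section generating_polynomials.
Variable R : realFieldType.
Implicit Types (a b : R) (p : {poly R}).

(* The generating polynomial of one trial; [lowmass k] of a product of such
   polynomials is the probability of fewer than [k] successes. *)
Definition bpoly a : {poly R} := 1 + a *: ('X - 1).

Definition lowmass k p : R := \sum_(j < k) p`_j.

Lemma coef_bpolyM a p k :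
  (bpoly a * p)`_k = p`_k + a * ((if k is j.+1 then p`_j else 0) - p`_k).
Proof.
rewrite /bpoly mulrDl mul1r -scalerAl mulrBl mul1r coefD coefZ coefB coefXM.
by case: k.
Qed.

(** Coefficients of [('X - 1) * p] are differences of neighbouring coefficients of [p], so the
    partial sum telescopes. *)
Lemma lowmass_XB1M k p : lowmass k.+1 (('X - 1) * p) = - p`_k.
Proof.
rewrite /lowmass; elim: k => [|k IH].
  by rewrite big_ord_recr big_ord0 /= mulrBl mul1r coefB coefXM /= add0r sub0r.
rewrite big_ord_recr /= IH mulrBl mul1r coefB coefXM /=; ring.
Qed.

Lemma lowmass0 k : lowmass k 0 = 0.
Proof. by rewrite /lowmass big1 // => j _; rewrite coef0. Qed.

Lemma lowmassD k : {morph lowmass k : p r / p + r}.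
Proof.
by move=> p r; rewrite /lowmass -big_split; apply: eq_bigr => j _; rewrite coefD.
Qed.

Lemma lowmassZ k a p : lowmass k (a *: p) = a * lowmass k p.
Proof. by rewrite /lowmass mulr_sumr; apply: eq_bigr => j _; rewrite coefZ. Qed.

(* With [p] generating the other trials, this is the coefficient of [a * b] in
   the probability of at most [k] successes. *)
Definition pairgap k p : R := p`_k - (if k is j.+1 then p`_j else 0).

(** Both factors are expanded in ['X - 1], and each resulting sum telescopes. With [a + b] fixed,
    only the product [a * b] still varies. *)
Lemma lowmass_bpoly2 k a b p :
  lowmass k.+1 (bpoly a * (bpoly b * p)) =
  lowmass k.+1 p - (a + b) * p`_k + a * b * pairgap k p.
Proof.
have -> : bpoly a * (bpoly b * p) =
    p + (a + b) *: (('X - 1) * p) + (a * b) *: (('X - 1) * (('X - 1) * p)).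
  rewrite /bpoly -!mul_polyC !(polyCD, polyCM); ring.
rewrite !(lowmassD, lowmassZ) !lowmass_XB1M mulrBl mul1r coefB coefXM /pairgap.
by case: k => [|k] /=; ring.
Qed.

Lemma bpolyE a : bpoly a = (1 - a)%:P + a *: 'X.
Proof. by rewrite /bpoly -!mul_polyC !(polyCD, polyCN); ring. Qed.

Lemma bpoly0 : bpoly 0 = 1.
Proof. by rewrite /bpoly scale0r addr0. Qed.

Lemma bpoly1 : bpoly 1 = 'X.
Proof. by rewrite /bpoly scale1r addrC subrK. Qed.

(** * Binomial weights and tails *)

Definition binpmf N j a : R := 'C(N, j)%:R * a ^+ j * (1 - a) ^+ (N - j).

Lemma coef_bpolyX N j a : (bpoly a ^+ N)`_j = binpmf N j a.
Proof.
rewrite bpolyE exprDn coef_sum /binpmf.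
have E (i : 'I_N.+1) : ((1 - a)%:P ^+ (N - i) * (a *: 'X) ^+ i *+ 'C(N, i))`_j =
    if i == j :> nat then binpmf N j a else 0.
  rewrite coefMn -polyC_exp coefCM exprZn coefZ coefXn eq_sym.
  case: eqP => [->|_]; last by rewrite !mulr0 mul0rn.
  by rewrite /binpmf mulr1 -mulr_natl; ring.
rewrite (eq_bigr _ (fun i _ => E i)) -big_mkcond /=.
have [jN|jN] := ltnP j N.+1.
  by rewrite (big_pred1 (Ordinal jN)).
rewrite big_pred0 => [|i]; first by rewrite /binpmf bin_small// !mul0r.
by apply/negbTE; rewrite neq_ltn (leq_trans (ltn_ord i) jN).
Qed.

Definition bincdf N k a : R := \sum_(j < k) binpmf N j a.

Lemma lowmass_bpolyX N k a : lowmass k (bpoly a ^+ N) = bincdf N k a.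
Proof. by apply: eq_bigr => j _; rewrite coef_bpolyX. Qed.

Lemma binpmf_ge0 N j a : 0 <= a <= 1 -> 0 <= binpmf N j a.
Proof.
by case/andP=> a0 a1; rewrite !mulr_ge0 ?ler0n ?exprn_ge0 ?subr_ge0.
Qed.

Lemma binpmf_ratio N r a :
  r.+1%:R * (1 - a) * binpmf N r.+1 a = (N - r)%:R * a * binpmf N r a.
Proof.
rewrite /binpmf; have [rN|Nr] := ltnP r N; last first.
  by rewrite bin_small// (eqP Nr) !mul0r mulr0.
have -> : (N - r = (N - r.+1).+1)%N by rewrite -subSn.
transitivity ((r.+1 * 'C(N, r.+1))%:R * a ^+ r.+1 * (1 - a) ^+ (N - r.+1).+1).
  rewrite natrM !exprS; ring.
by rewrite mul_bin_left subnSK// natrM !exprS; ring.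
Qed.

(** Unimodality: by [binpmf_ratio], an increase from [r] to [r.+1] forces
    [r.+1%:R * (1 - a) < (N - r)%:R * a]. *)
Lemma binpmf_incr N r a : 0 < a < 1 -> binpmf N r a < binpmf N r.+1 a ->
  r.+1%:R < N.+1%:R * a.
Proof.
move=> /andP[a0 a1] lt_r.
have p0 : 0 <= binpmf N r a by rewrite binpmf_ge0// !ltW.
have rN : (r < N)%N.
  rewrite ltnNge; apply/negP => Nr; move: lt_r.
  by rewrite [X in _ < X]/binpmf bin_small// !mul0r ltNge p0.
have c0 : 0 < (N - r)%:R * a by rewrite mulr_gt0// ltr0n subn_gt0.
have := binpmf_ratio N r a.
have lt2 : (N - r)%:R * a * binpmf N r a < (N - r)%:R * a * binpmf N r.+1 a.
  by rewrite ltr_pM2l.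
move=> E; move: lt2; rewrite -E ltr_pM2r ?(le_lt_trans p0)//.
rewrite natrB ?(ltnW rN)//.
rewrite -!natr1; lra.
Qed.

Lemma bincdf_full N a : bincdf N N.+1 a = 1.
Proof.
transitivity ((1 - a + a) ^+ N); last by rewrite subrK expr1n.
rewrite exprDn; apply: eq_bigr => i _.
by rewrite /binpmf -mulr_natl; ring.
Qed.

(** Exchange of successes and failures: fewer than [k] successes means at least [N.+1 - k]
    failures. *)
Lemma bincdf_reflect N k a : (k <= N.+1)%N ->
  bincdf N k a = 1 - bincdf N (N.+1 - k) (1 - a).
Proof.
move=> kN; rewrite -[X in _ = X - _](bincdf_full N a) /bincdf.
rewrite -!(big_mkord xpredT (fun j => binpmf N j _)).
rewrite [X in _ = X - _](big_cat_nat (n := k))//=.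
rewrite -[LHS]addr0 -addrA; congr (_ + _); apply/esym/eqP; rewrite subr_eq0.
have [M E] : exists M, N.+1 = (k + M)%N by exists (N.+1 - k)%N; rewrite subnKC.
rewrite E addKn -{1}[k]add0n big_addn addKn big_nat_rev /= add0n.
apply/eqP/eq_big_nat => i /andP[_ iM].
have -> : (M - i.+1 + k = N - i)%N by lia.
have iN : (i <= N)%N by lia.
rewrite /binpmf bin_sub// subKn// subKr; ring.
Qed.

End generating_polynomials.

(** * Extremal vectors of success probabilities *)

Lemma cvg_sumr (R : realType) (T : Type) (F : set_system T) (I : Type)
    (r : seq I) (f : I -> T -> R) (l : I -> R) : Filter F ->
  (forall i, f i x @[x --> F] --> l i) ->
  \sum_(i <- r) f i x @[x --> F] --> \sum_(i <- r) l i.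
Proof.
move=> FF fl; apply: cvg_big => // x.
exact: (@add_continuous (R : TopologicalNmodule.type)).
Qed.

Lemma continuous_sumr (R : realType) (T : topologicalType) (I : Type)
    (r : seq I) (F : I -> T -> R) :
  (forall i, continuous (F i)) -> continuous (fun x => \sum_(i <- r) F i x).
Proof. by move=> cF x; apply: cvg_sumr => i; exact: cF. Qed.

Section extremal.
Variables (R : realType) (n : nat).
Implicit Types (q : 'I_n -> R).

Definition pgf q : {poly R} := \prod_i bpoly (q i).

Lemma continuous_coef_prod (T : topologicalType) (r : seq 'I_n)
    (F : 'I_n -> T -> R) k : (forall i, continuous (F i)) ->
  continuous (fun v => (\prod_(i <- r) bpoly (F i v))`_k).
Proof.
move=> cF; elim: r k => [|i r IH] k v.
  under eq_fun do rewrite big_nil; exact: cst_continuous.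
under eq_fun do rewrite big_cons coef_bpolyM.
apply: cvgD; first exact: IH.
apply: cvgM; first exact: cF.
apply: cvgB; last exact: IH.
case: k => [|k]; [exact: cvg_cst | exact: IH].
Qed.

Lemma continuous_lowmass k :
  continuous (fun v : 'rV[R]_n => lowmass k (pgf (fun i => v 0 i))).
Proof.
apply: continuous_sumr => j.
by apply: continuous_coef_prod => i; exact: coord_continuous.
Qed.

Definition otherpgf q i j : {poly R} :=
  \prod_(l | (l != i) && (l != j)) bpoly (q l).

Lemma pgf_pair q i j : i != j ->
  pgf q = bpoly (q i) * (bpoly (q j) * otherpgf q i j).
Proof.
move=> ij; rewrite /pgf (bigD1 i)//= (bigD1 j) 1?eq_sym//.
Qed.

Definition upd2 q i j x y : 'I_n -> R :=
  fun l => if l == i then x else if l == j then y else q l.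

Lemma sum_upd2 (f : R -> R) q i j x y : i != j ->
  \sum_l f (upd2 q i j x y l) = \sum_l f (q l) - f (q i) - f (q j) + f x + f y.
Proof.
move=> ij; rewrite (bigD1 i)//= (bigD1 j) 1?eq_sym//=.
rewrite [in RHS](bigD1 i)//= [in RHS](bigD1 j) 1?eq_sym//=.
rewrite /upd2 eqxx eq_sym (negbTE ij) eqxx.
have -> : \sum_(l | (l != i) && (l != j))
   f (if l == i then x else if l == j then y else q l) =
  \sum_(l | (l != i) && (l != j)) f (q l).
  by apply: eq_bigr => l /andP[/negbTE-> /negbTE->].
ring.
Qed.

Lemma lowmass_upd2 k q i j x y : i != j -> x + y = q i + q j ->
  lowmass k.+1 (pgf (upd2 q i j x y)) =
  lowmass k.+1 (pgf q) + (x * y - q i * q j) * pairgap k (otherpgf q i j).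
Proof.
move=> ij E; rewrite !(pgf_pair _ ij) /upd2 eqxx eq_sym (negbTE ij) eqxx.
have -> : otherpgf (fun l => if l == i then x else if l == j then y else q l) i j
   = otherpgf q i j.
  by apply: eq_bigr => l /andP[/negbTE-> /negbTE->].
rewrite !lowmass_bpoly2 E; ring.
Qed.

Lemma extremal_exists k q0 : (forall i, 0 <= q0 i <= 1) ->
  exists q, [/\ forall i, 0 <= q i <= 1, \sum_i q i = \sum_i q0 i,
    lowmass k.+1 (pgf q) <= lowmass k.+1 (pgf q0) &
    forall i j, q i < q j ->
      0 < pairgap k (otherpgf q i j) /\ (q i = 0 \/ q j = 1)].
Proof.
move=> q01.
pose L (v : 'rV[R]_n) := lowmass k.+1 (pgf (fun i => v 0 i)).
pose s1 (v : 'rV[R]_n) := \sum_i v 0 i.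
pose s2 (v : 'rV[R]_n) := \sum_i (v 0 i) ^+ 2.
have cL : continuous L by exact: continuous_lowmass.
have cs1 : continuous s1.
  apply: continuous_sumr => i.
  exact: coord_continuous.
have cs2 : continuous s2.
  apply: continuous_sumr => i v.
  by apply: (@continuous_comp _ _ _ (fun v : 'rV[R]_n => v 0 i) (fun z => z ^+ 2));
    [exact: coord_continuous | exact: exprn_continuous].
pose K := [set v : 'rV[R]_n | forall i, `[0, 1]%classic (v 0 i)] `&`
  s1 @^-1` [set \sum_i q0 i].
have cK : compact K.
  apply: compact_closedI; last first.
    by apply: preimage_closed; [move=> ? _; exact: cs1 | exact: closed_eq].
  apply: (@rV_compact R n (fun=> `[0, 1]%classic)) => i.
  exact: segment_compact.
pose v0 : 'rV[R]_n := \row_i q0 i.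
have v0E : (fun i => v0 0 i) = q0 by apply/funext => i; rewrite mxE.
have Kv0 : K v0.
  split; first by move=> i /=; rewrite mxE in_itv/= q01.
  by rewrite /= /s1; apply: eq_bigr => i _; rewrite mxE.
have K0 : K !=set0 by exists v0.
have [v1 /set_mem Kv1 minL] := compact_EVT_min K0 cK (continuous_subspaceT cL).
(* A second minimisation, of the sum of squares over the minimisers of [L], decides the case where
   an exchange leaves [L] unchanged. *)
pose K' := K `&` L @^-1` [set L v1].
have cK' : compact K'.
  apply: compact_closedI => //.
  by apply: preimage_closed; [move=> ? _; exact: cL | exact: closed_eq].
have K'0 : K' !=set0 by exists v1.
have [v /set_mem [[Kv s1v] Lv] mins2] :=
  compact_EVT_min K'0 cK' (continuous_subspaceT cs2).
pose q := fun i => v 0 i.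
(* Moving two coordinates with their sum fixed changes [L] by [g], so [g] is nonnegative; if
   [g = 0], the new vector is again a minimiser and cannot have a smaller sum of squares. *)
have upd i j x y : i != j -> x + y = q i + q j -> 0 <= x <= 1 -> 0 <= y <= 1 ->
  let g := (x * y - q i * q j) * pairgap k (otherpgf q i j) in
  0 <= g /\ (g = 0 -> q i ^+ 2 + q j ^+ 2 <= x ^+ 2 + y ^+ 2).
  move=> ij E x01 y01 g.
  pose w : 'rV[R]_n := \row_l upd2 q i j x y l.
  have wE : (fun i => w 0 i) = upd2 q i j x y by apply/funext => l; rewrite mxE.
  have LwE : L w = L v + g by rewrite /L wE lowmass_upd2.
  have Kw : K w.
    split.
      move=> l /=; rewrite mxE in_itv/= /upd2.
      by case: eqP => // _; case: eqP => // _; have := Kv l; rewrite /= in_itv.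
    rewrite /= -s1v /s1; under eq_bigr do rewrite mxE.
    by rewrite (sum_upd2 id)//=; move: E; rewrite /q; lra.
  split; first by have := minL w (mem_set Kw); rewrite LwE Lv lerDl.
  move=> g0; have : s2 v <= s2 w.
    by apply: mins2; apply/mem_set; split; rewrite //= LwE g0 addr0.
  rewrite /s2; under [leRHS]eq_bigr do rewrite mxE.
  rewrite (sum_upd2 (fun z => z ^+ 2))//= -/(q i) -/(q j); lra.
have Kq i : 0 <= q i <= 1 by have := Kv i; rewrite /= in_itv.
exists q; split=> //.
  by have := minL v0 (mem_set Kv0); rewrite -Lv /L v0E.
move=> i j lt_ij; have ij : i != j by apply: contraTneq lt_ij => ->; rewrite ltxx.
have := Kq i; have := Kq j => qj qi.
have gap_gt0 : 0 < pairgap k (otherpgf q i j).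
  (* Equalising raises the product and strictly lowers the sum of squares: a negative gap would
     contradict [0 <= g], a zero gap the choice of [v]. *)
  pose m := (q i + q j) / 2.
  have m01 : 0 <= m <= 1 by rewrite /m; lra.
  have [|g0 gE] := upd i j m m ij _ m01 m01; first by rewrite /m; lra.
  have mE : m * m - q i * q j = ((q j - q i) / 2) ^+ 2 by rewrite /m; field.
  have m0 : 0 < m * m - q i * q j.
    by rewrite mE exprn_gt0// divr_gt0// subr_gt0.
  move: g0; rewrite pmulr_rge0// le_eqVlt => /predU1P[g0|//].
  have := gE; rewrite -g0 mulr0 => /(_ erefl).
  have -> : m ^+ 2 + m ^+ 2 = q i ^+ 2 + q j ^+ 2 - 2 * ((q j - q i) / 2) ^+ 2.
    by rewrite /m; field.
  by have := m0; rewrite mE; lra.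
split=> //.
(* [t] is the largest spread that stays in the unit interval. It lowers the product by
   [t * (q j - q i + t)], so the positive gap forces [t = 0]. *)
pose t := Num.min (q i) (1 - q j).
have [ti tj] : t <= q i /\ t <= 1 - q j by rewrite /t !ge_min !lexx ?orbT.
have t0 : 0 <= t by rewrite le_min; lra.
have [|||g0 _] := upd i j (q i - t) (q j + t) ij; [lra|lra|lra|].
have {}g0 : 0 <= (q i - t) * (q j + t) - q i * q j by rewrite pmulr_lge0 in g0.
have tE : t = 0.
  apply/eqP; rewrite eq_le t0 andbT leNgt; apply/negP => tgt.
  have : 0 < t * (q j - q i + t) by rewrite mulr_gt0//; lra.
  lra.
have := tE; rewrite /t minEle; case: ifP => _; lra.
Qed.

(** The polynomial describes [o] sure successes and [m] trials of probability [a]; the shift by [o]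
    reduces the claim to [binpmf_incr]. *)
Lemma pairgap_gt0 k o m (a : R) : 0 < a < 1 ->
  0 < pairgap k ('X^o * bpoly a ^+ m) -> k%:R < o%:R + m.+1%:R * a.
Proof.
move=> a01; have [a0 a1] := andP a01.
have ma0 : 0 < m.+1%:R * a by rewrite mulr_gt0// ltr0n.
rewrite /pairgap; case: k => [|k]; first by move=> _; rewrite ltr_wpDl// ler0n.
rewrite !coefXnM !coef_bpolyX; have [ko|ok] := ltnP k.+1 o.
  by rewrite (ltn_trans _ ko)// subrr ltxx.
have [ko _|{}ok] := ltnP k o.
  by rewrite (@le_lt_trans _ _ o%:R) ?ler_nat// ltrDl.
rewrite subr_gt0 subSn// => /(binpmf_incr a01).
by rewrite -!natr1 natrB//; lra.
Qed.

Lemma three_valued_pgf q (P : pred 'I_n) a :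
  (forall l, P l -> [\/ q l = 0, q l = 1 | q l = a]) ->
  exists o m, \prod_(l | P l) bpoly (q l) = 'X^o * bpoly a ^+ m /\
    \sum_(l | P l) q l = o%:R + m%:R * a.
Proof.
move=> qP; pose K p s := exists o m, p = 'X^o * bpoly a ^+ m /\ s = o%:R + m%:R * a.
suff : K (\prod_(l | P l) bpoly (q l)) (\sum_(l | P l) q l) by [].
elim/big_rec2: _ => [|l p s /qP ql [c [m [-> ->]]]].
  by exists 0%N, 0%N; rewrite !expr0; split; ring.
case: ql => ->; rewrite ?bpoly0 ?bpoly1.
- by exists c, m; split; ring.
- by exists c.+1, m; rewrite exprS -natr1; split; ring.
- by exists c, m.+1; rewrite [bpoly a ^+ m.+1]exprS -natr1; split; ring.
Qed.

Lemma two_valued_pgf q (P : pred 'I_n) a :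
  (forall l, P l -> q l = 0 \/ q l = a) ->
  exists m, [/\ (m <= \sum_(l | P l) 1)%N,
    \prod_(l | P l) bpoly (q l) = bpoly a ^+ m & \sum_(l | P l) q l = m%:R * a].
Proof.
move=> qP; pose K p s N := exists m, [/\ (m <= N)%N, p = bpoly a ^+ m & s = m%:R * a].
suff : K (\prod_(l | P l) bpoly (q l)) (\sum_(l | P l) q l) (\sum_(l | P l) 1)%N by [].
elim/big_rec3: _ => [|l N s p Pl [m [mN -> ->]]].
  by exists 0%N; rewrite expr0 mul0r.
case: (qP l Pl) => ->; rewrite ?bpoly0.
- by exists m; split; [lia | ring | ring].
- by exists m.+1; rewrite exprS -natr1; split; [lia | ring | ring].
Qed.

Lemma lowmass_Xn k m : lowmass k ('X^m : {poly R}) = (m < k)%:R.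
Proof.
rewrite /lowmass; under eq_bigr do rewrite coefXn.
have [mk|km] := ltnP m k; last first.
  by rewrite big1 // => j _; rewrite ltn_eqF// (leq_trans (ltn_ord j)).
rewrite (bigD1 (Ordinal mk))//= eqxx big1 ?addr0// => j jm.
by case: eqP => // E; case/eqP: jm; exact: val_inj.
Qed.

(** Either the vector from [extremal_exists] has only entries 0 and 1, so its count is constant and
    below [k.+1], or it has an entry [a] strictly between; then it consists of [m] entries [a] and
    zeros, and no zero remains once the sum is at most [k]. *)
Lemma hoeffding_bound k q0 : (forall i, 0 <= q0 i <= 1) ->
    \sum_i q0 i < k.+1%:R ->
  1 <= lowmass k.+1 (pgf q0) \/
  exists m a, [/\ (m <= n)%N, 0 <= a <= 1, m%:R * a = \sum_i q0 i,
    bincdf m k.+1 a <= lowmass k.+1 (pgf q0) & \sum_i q0 i <= k%:R -> m = n].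
Proof.
move=> q01 ltk; have [q [{}q01 sq ltL qP]] := extremal_exists k q01.
rewrite -sq in ltk *.
have [|no_int] := pselect (exists i, 0 < q i < 1); last first.
  left; apply: le_trans ltL.
  have q2 l : [\/ q l = 0, q l = 1 | q l = 0].
    have [ql0|ql0] := eqVneq (q l) 0; first by constructor 1.
    have [ql1|ql1] := eqVneq (q l) 1; first by constructor 2.
    case: no_int; exists l; have /andP[l0 l1] := q01 l.
    by rewrite !lt_neqAle eq_sym ql0 ql1 l0 l1.
  have [c [m []]] := @three_valued_pgf q xpredT 0 (fun l _ => q2 l).
  rewrite bpoly0 expr1n mulr1 mulr0 addr0 => E s; rewrite s ltr_nat in ltk.
  by rewrite /pgf E lowmass_Xn ltk.
move=> [i ai]; set a := q i in ai; have [a0 a1] := andP ai.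
right.
(* As [0 < a < 1], the boundary condition in [qP] sends entries below [a] to 0 and entries above [a]
   to 1. *)
have q3 l : [\/ q l = 0, q l = 1 | q l = a].
  have [h|h|h] := ltgtP (q l) a; last by constructor 3.
  - by have [_ []] := qP _ _ h; [constructor 1 | rewrite -/a; lra].
  - by have [_ []] := qP _ _ h; [rewrite -/a; lra | constructor 2].
(* For an entry 1 paired with [a], [pairgap_gt0] gives [k%:R < c%:R + m.+1%:R * a]; adding the entry
   1 puts the whole sum above [k.+1]. *)
have q2 l : q l = 0 \/ q l = a.
  case: (q3 l) => [->|ql|->]; [by left | exfalso | by right].
  have /qP[gap _] : q i < q l by rewrite ql.
  have il : i != l by apply/eqP => il; move: a1; rewrite /a il ql ltxx.
  have [c [m [E s]]] :=
    @three_valued_pgf q (fun j => (j != i) && (j != l)) a (fun j _ => q3 j).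
  rewrite /otherpgf E in gap; have := pairgap_gt0 ai gap.
  move: ltk; rewrite (bigD1 i)//= (bigD1 l) 1?eq_sym//= s ql -/a -!natr1; lra.
have a01 : 0 <= a <= 1 by lra.
have [m [mn E s]] := @two_valued_pgf q xpredT a (fun l _ => q2 l).
rewrite sum1_card card_ord in mn.
exists m, a; split=> //; first by rewrite -lowmass_bpolyX -E.
move=> lek.
(* An entry 0 paired with [a] leaves the sum [m'.+1%:R * a], which [pairgap_gt0] puts above [k]. *)
have qa l : q l = a.
  case: (q2 l) => // ql; exfalso.
  have /qP[gap _] : q l < q i by rewrite ql.
  have il : i != l by apply/eqP => il; move: a0; rewrite /a il ql ltxx.
  have [m' [_ E' s']] :=
    @two_valued_pgf q (fun j => (j != l) && (j != i)) a (fun j _ => q2 j).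
  rewrite /otherpgf E' -[bpoly a ^+ _]mul1r -(expr0 'X) in gap.
  have := pairgap_gt0 ai gap.
  move: lek; rewrite (bigD1 l)//= (bigD1 i)//= s' ql -/a -!natr1; lra.
move: s; rewrite (eq_bigr (fun=> a)) => [|l _]; last exact: qa.
rewrite sumr_const card_ord -[a *+ n]mulr_natl => /(mulIf (lt0r_neq0 a0))/eqP.
by rewrite eqr_nat eq_sym => /eqP.
Qed.

End extremal.

(** * Incomplete Beta functions at integers *)

Section beta.
Variable R : realType.
Implicit Types (p : {poly R}) (x t : R).

(** The exponential dominates the term of degree [n.+1] of its series, which leaves a bound of order
    [t^-1]. *)
Lemma cvgr_Xn_expRN n : t ^+ n * expR (- t) @[t --> +oo] --> (0 : R).
Proof.
apply: (@squeeze_cvgr _ _ _ _ (cst 0) (fun t => n.+1`!%:R * t^-1)).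
- near=> t; have t0 : 0 < t by near: t; exact: nbhs_pinfty_gt.
  rewrite /= mulr_ge0 ?exprn_ge0 ?expR_ge0 ?(ltW t0)//=.
  rewrite expRN ler_pdivrMr ?expR_gt0//.
  rewrite mulrAC ler_pdivlMr// -exprSr.
  have := @expR_ge1Dxn R t n (ltW t0); rewrite -lerBrDl => /le_trans h.
  have : t ^+ n.+1 / n.+1`!%:R <= expR t by apply: h; rewrite gerBl.
  by rewrite ler_pdivrMr ?ltr0n ?fact_gt0// mulrC.
- exact: cvg_cst.
- rewrite -[0](mulr0 n.+1`!%:R); apply: cvgM; first exact: cvg_cst.
  by apply/gtr0_cvgV0; [exact: nbhs_pinfty_gt | exact: cvg_id].
Unshelve. all: by end_near. Qed.

Lemma cvgr_poly_expRN p : p.[t] * expR (- t) @[t --> +oo] --> (0 : R).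
Proof.
have -> : (fun t => p.[t] * expR (- t)) =
    (fun t => \sum_(i < size p) p`_i * (t ^+ i * expR (- t))).
  apply/funext => t; rewrite horner_coef mulr_suml.
  by apply: eq_bigr => i _; rewrite mulrA.
have := @cvg_sumr R R +oo _ (index_enum 'I_(size p))
  (fun i t => p`_i * (t ^+ i * expR (- t))) (fun i => p`_i * 0) _.
rewrite [\sum_(i <- _) _ * 0]big1 => [|i _]; last by rewrite mulr0.
by apply=> i; apply: cvgM; [exact: cvg_cst | exact: cvgr_Xn_expRN].
Qed.

Lemma is_derive_poly_expRN p x :
  is_derive x 1 (fun t => p.[t] * expR (- t)) ((p^`() - p).[x] * expR (- x)).
Proof.
have dN : is_derive x 1 (fun t => expR (- t)) (expR (- x) * - 1).
  exact: is_derive1_comp.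
have h := is_deriveM (is_derive_poly p x) dN.
by apply: (is_derive_eq h); rewrite hornerD hornerN /GRing.scale /=; ring.
Qed.

Lemma continuous_poly_expRN p : continuous (fun t => p.[t] * expR (- t)).
Proof.
move=> x; apply/differentiable_continuous/derivable1_diffP.
by have [] := is_derive_poly_expRN p x.
Qed.

(* [- gamma_poly n * exp (- t)] is a primitive of [t ^+ n * exp (- t)]. *)
Fixpoint gamma_poly n : {poly R} :=
  if n is m.+1 then 'X^n + n%:R *: gamma_poly m else 1.

Lemma gamma_poly_deriv n : gamma_poly n - (gamma_poly n)^`() = 'X^n.
Proof.
elim: n => [|n IH] /=; first by rewrite derivC subr0.
by rewrite derivD derivXn derivZ opprD addrACA -scalerBr IH scaler_nat subrK.
Qed.

Lemma gamma_poly0 n : (gamma_poly n).[0] = n`!%:R.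
Proof.
elim: n => [|n IH] /=; first by rewrite hornerC.
by rewrite !hornerE IH expr0n /= add0r factS natrM.
Qed.

Lemma Gamma_natS n : Gamma (n.+1%:R : R) = n`!%:R.
Proof.
rewrite /Gamma /Rintegral.
have E (t : R) : 0 <= t -> t `^ (n.+1%:R - 1) * expR (- t) = 'X^n.[t] * expR (- t).
  by move=> t0; rewrite -natr1 addrK powR_mulrn// hornerXn.
under eq_integral => t /[!inE]/= /[!in_itv]/= /andP[t0 _] do rewrite (E _ (ltW t0)).
rewrite integral_itv_obnd_cbnd; last first.
  apply/measurable_EFinP; apply: measurable_funTS => //.
  by apply: continuous_measurable_fun; exact: continuous_poly_expRN.
rewrite (@ge0_continuous_FTC2y _ _ (fun t => (- gamma_poly n).[t] * expR (- t)) 0 0).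
- rewrite sub0e /= oppr0 expR0 mulr1 hornerN opprK; exact: gamma_poly0.
- by move=> x x0; rewrite mulr_ge0 ?expR_ge0// hornerXn exprn_ge0.
- exact/continuous_subspaceT/continuous_poly_expRN.
- exact: cvgr_poly_expRN.
- by move=> x _; have [] := is_derive_poly_expRN (- gamma_poly n) x.
- exact/cvg_at_right_filter/continuous_poly_expRN.
- move=> x _; rewrite derive1E; have [_ ->] := is_derive_poly_expRN (- gamma_poly n) x.
  by rewrite derivN opprK addrC gamma_poly_deriv.
Qed.

(** The binomial distribution function as a polynomial in the success probability, ready for formal
    differentiation. *)
Definition bincdf_poly N k : {poly R} :=
  \sum_(j < k) 'C(N, j)%:R *: ('X^j * (1 - 'X) ^+ (N - j)).

Lemma horner_bincdf_poly N k x : (bincdf_poly N k).[x] = bincdf N k x.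
Proof.
rewrite /bincdf_poly horner_sum; apply: eq_bigr => j _.
by rewrite hornerZ hornerM hornerXn horner_exp !hornerE /binpmf.
Qed.

(** The derivatives of successive terms telescope; what survives is a multiple of the Beta
    integrand. *)
Lemma bincdf_poly_deriv N k : (k < N)%N ->
  (bincdf_poly N k.+1)^`() =
  - (((N - k) * 'C(N, k))%:R *: ('X^k * (1 - 'X) ^+ (N - k.+1))).
Proof.
have dXn m : ((1 - 'X) ^+ m)^`() = - (m%:R *: (1 - 'X : {poly R}) ^+ m.-1).
  by rewrite deriv_exp derivB derivC derivX sub0r mulN1r scaler_nat mulNrn.
elim: k => [|k IH] kN.
  rewrite /bincdf_poly big_ord_recr big_ord0 /= add0r bin0 scale1r expr0 !mul1r.
  by rewrite dXn subn0 muln1 subn1.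
rewrite /bincdf_poly big_ord_recr /= derivD -/(bincdf_poly N k.+1) IH 1?ltnW//.
rewrite -mul_bin_left derivZ derivM derivXn dXn /=.
have -> : (N - k.+1).-1 = (N - k.+2)%N by lia.
rewrite -!mul_polyC !natrM !(polyCM, polyC_natr) -mulr_natl; ring.
Qed.

Lemma bincdf0 N k : bincdf N k.+1 (0 : R) = 1.
Proof.
rewrite /bincdf big_ord_recl big1 => [|j _]; rewrite /binpmf.
  by rewrite bin0 expr0 subr0 expr1n !mulr1 addr0.
by rewrite expr0n /= mulr0 mul0r.
Qed.

Lemma bincdf1 N k : (k <= N)%N -> bincdf N k (1 : R) = 0.
Proof.
move=> kN; rewrite /bincdf big1// => j _; rewrite /binpmf subrr expr0n subn_eq0.
by rewrite leqNgt (leq_trans (ltn_ord j) kN) mulr0.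
Qed.

(** By [bincdf_poly_deriv] the distribution function is, up to the factor [- c], a primitive of the
    Beta integrand, and [c] is exactly the normalising Gamma quotient. *)
Lemma inc_beta_bincdf k m x : 0 <= x <= 1 ->
  inc_beta k.+1%:R m.+1%:R x = 1 - bincdf (k + m).+1 k.+1 x.
Proof.
move=> /andP[x0 x1]; rewrite /inc_beta.
have -> : k.+1%:R + m.+1%:R = (k + m).+2%:R :> R by rewrite -natrD addSn addnS.
rewrite !Gamma_natS /Rintegral.
have E (t : R) : 0 <= t <= 1 ->
    t `^ (k.+1%:R - 1) * (1 - t) `^ (m.+1%:R - 1) = ('X^k * (1 - 'X) ^+ m).[t].
  move=> /andP[t0 t1]; rewrite -!natr1 !addrK !powR_mulrn ?subr_ge0//.
  by rewrite hornerM hornerXn horner_exp !hornerE.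
have {}E t : 0 <= t <= x -> t `^ (k.+1%:R - 1) * (1 - t) `^ (m.+1%:R - 1) =
    ('X^k * (1 - 'X) ^+ m).[t].
  by move=> /andP[t0 tx]; rewrite E// t0 (le_trans tx).
under eq_integral => t /[!inE]/= /[!in_itv]/= t0x do rewrite (E _ t0x).
move: x0; rewrite le_eqVlt => /predU1P[<-|x0].
  by rewrite set_itv1 integral_set1 mulr0 bincdf0 subrr.
set c : R := (((k + m).+1 - k) * 'C((k + m).+1, k))%:R.
have c0 : c != 0.
  by rewrite pnatr_eq0 muln_eq0 negb_or -!lt0n subn_gt0 bin_gt0; lia.
pose F := - c^-1 *: bincdf_poly (k + m).+1 k.+1.
rewrite (@continuous_FTC2 _ _ (horner F))//; last 3 first.
- exact/continuous_subspaceT/continuous_horner.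
- split.
  + by move=> t _; exact: derivable_horner.
  + exact/cvg_at_right_filter/continuous_horner.
  + exact/cvg_at_left_filter/continuous_horner.
- move=> t _; rewrite derive1E; have [_ ->] := is_derive_poly F t.
  rewrite derivZ bincdf_poly_deriv; last by lia.
  rewrite scaleNr scalerN opprK scalerA mulVf// scale1r.
  by have -> : ((k + m).+1 - k.+1 = m)%N by lia.
rewrite /= /F !hornerZ !horner_bincdf_poly bincdf0.
have -> : (k + m).+1`!%:R / (k`!%:R * m`!%:R) = c.
  rewrite /c -(@bin_fact (k + m).+1 k); last by lia.
  have -> : ((k + m).+1 - k = m.+1)%N by lia.
  rewrite factS !natrM; field.
  by rewrite !pnatr_eq0 -!lt0n !fact_gt0.
by rewrite mulrBr mulrA mulrN divff// mulr1 mulN1r mulrN divff// opprK addrC.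
Qed.

Lemma continuous_bincdf N k : continuous (bincdf N k : R -> R).
Proof.
have -> : bincdf N k = horner (bincdf_poly N k).
  by apply/funext => x; rewrite horner_bincdf_poly.
exact: continuous_horner.
Qed.

Lemma bincdf_lt N k : (k < N)%N ->
  {in `[0, 1] &, {homo (bincdf N k.+1 : R -> R) : x y /~ x < y}}.
Proof.
move=> kN.
have -> : bincdf N k.+1 = horner (bincdf_poly N k.+1).
  by apply/funext => x; rewrite horner_bincdf_poly.
apply: ltr0_derive1_lt_cc.
- by move=> x _; exact: derivable_horner.
- move=> x; rewrite in_itv/= => /andP[x0 x1].
  rewrite derive1E; have [_ ->] := is_derive_poly (bincdf_poly N k.+1) x.
  rewrite bincdf_poly_deriv// hornerN oppr_lt0 hornerZ hornerM hornerXn.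
  have c0 : 0 < ((N - k) * 'C(N, k))%:R :> R.
    by rewrite ltr0n muln_gt0 subn_gt0 kN bin_gt0 ltnW.
  by rewrite horner_exp !hornerE !mulr_gt0 ?exprn_gt0 ?subr_gt0.
- exact/continuous_subspaceT/continuous_horner.
Qed.

Lemma bincdf_le N k : (k < N)%N ->
  {in `[0, 1] &, {homo (bincdf N k.+1 : R -> R) : x y /~ x <= y}}.
Proof.
move=> kN x y x01 y01; rewrite le_eqVlt => /predU1P[->//|xy].
exact/ltW/bincdf_lt.
Qed.

(** The distribution function runs from 1 at 0 to 0 at 1, so a preimage exists and [xget] does not
    return its default. *)
Lemma inc_beta_invP k m (alpha : R) : 0 <= alpha <= 1 ->
  let x := inc_beta_inv k.+1%:R m.+1%:R alpha in
  0 <= x <= 1 /\ bincdf (k + m).+1 k.+1 x = 1 - alpha.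
Proof.
move=> alpha01 x.
have [y] : exists2 y, y \in `[0, 1] & bincdf (k + m).+1 k.+1 y = 1 - alpha :> R.
  apply: IVT => //; first exact/continuous_subspaceT/continuous_bincdf.
  rewrite bincdf0 bincdf1; last by lia.
  rewrite minEle maxEle ler10; lra.
rewrite in_itv/= => y01 yE.
have : [set x : R | 0 <= x <= 1 /\ inc_beta k.+1%:R m.+1%:R x = alpha] !=set0.
  by exists y; split => //=; rewrite inc_beta_bincdf// yE subKr.
move=> /(@xgetPex _ 0)[x01]; rewrite -/(inc_beta_inv _ _ _) -/x => xE.
by split=> //; rewrite -xE inc_beta_bincdf// subKr.
Qed.

End beta.

(** * Bernoulli families *)

Section weights.
Variables (R : realType) (n : nat) (q : 'I_n -> R).
Local Notation V := {ffun 'I_n -> bool}.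

Definition coinweight i (b : bool) : R := if b then q i else 1 - q i.

Definition weight (v : V) : R := \prod_i coinweight i (v i).

Definition ntrue (v : V) : nat := \sum_i v i.

Lemma sum_coinweight i : \sum_b coinweight i b = 1.
Proof. by rewrite big_bool /coinweight /= addrC subrK. Qed.

Lemma pgf_weight : pgf q = \sum_v weight v *: 'X^(ntrue v).
Proof.
rewrite /pgf (eq_bigr (fun i => \sum_b coinweight i b *: 'X^b)); last first.
  by move=> i _; rewrite big_bool /coinweight /= bpolyE addrC expr1 expr0 alg_polyC.
rewrite bigA_distr_bigA /=; apply: eq_bigr => v _.
by rewrite scaler_prod prodrXr.
Qed.

Lemma lowmass_pgf k :
  lowmass k (pgf q) = \sum_(v | (ntrue v < k)%N) weight v.
Proof.
rewrite pgf_weight (big_morph _ (lowmassD k) (lowmass0 _ k)) [RHS]big_mkcond.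
apply: eq_bigr => v _; rewrite lowmassZ lowmass_Xn.
by case: ifP => _; rewrite ?mulr1 ?mulr0.
Qed.

Hypothesis q01 : forall i, 0 <= q i <= 1.

Lemma weight_ge0 v : 0 <= weight v.
Proof.
apply: prodr_ge0 => i _; have /andP[q0 q1] := q01 i.
by rewrite /coinweight; case: ifP; rewrite ?subr_ge0.
Qed.

Lemma sum_weight : \sum_v weight v = 1.
Proof.
by rewrite -(bigA_distr_bigA coinweight) big1 // => i _; rewrite sum_coinweight.
Qed.

(* nat serves as a sample space with discrete sigma-algebra: the index of a
   vector in [enum V] stands for the vector. *)
Definition outcome (w : nat) : V := nth [ffun=> false] (enum V) w.

Definition coins : set nat -> \bar R :=
  msum (fun k => mscale (NngNum (weight_ge0 (outcome k))) (\d_k)) #|V|.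

HB.instance Definition _ := Measure.on coins.

Lemma coinsE (B : pred V) :
  coins [set w | B (outcome w)] = (\sum_(v | B v) weight v)%:E.
Proof.
have -> : \sum_(v | B v) weight v =
    \sum_(k < #|V|) if B (outcome k) then weight (outcome k) else 0.
  by rewrite big_mkcond -big_enum (big_nth [ffun=> false]) big_mkord -cardE.
rewrite -sumEFin; apply: eq_bigr => k _.
transitivity ((weight (outcome k))%:E *
  (\d_(k : nat) : set nat -> \bar R) [set w | B (outcome w)])%E; first by [].
rewrite diracE.
have -> : (k : nat) \in [set w | B (outcome w)] = B (outcome k).
  by apply/idP/idP; rewrite inE.
by case: (B _); rewrite ?mule1 ?mule0.
Qed.

Lemma coins_setT : coins setT = 1%E.
Proof.
by have := coinsE xpredT; rewrite sum_weight => <-; congr coins; apply/seteqP.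
Qed.

HB.instance Definition _ := Measure_isProbability.Build _ _ _ coins coins_setT.

Definition coin (i : 'I_n) (w : nat) : bool := outcome w i.

Lemma measurable_coin i : measurable_fun setT (coin i).
Proof. by []. Qed.

HB.instance Definition _ i :=
  isMeasurableFun.Build _ _ _ _ (coin i) (measurable_coin i).

(** A cylinder is a product set of outcome vectors, so its mass factorises by distributivity;
    indices outside [J] contribute the factor 1. *)
Lemma coins_cylinder (J : {set 'I_n}) (B : 'I_n -> set bool) :
  coins (\bigcap_(i in [set` J]) (coin i @^-1` B i)) =
  (\prod_(i in J) (\sum_(b | b \in B i) coinweight i b))%:E.
Proof.
pose Q i b := (i \in J) ==> (b \in B i).
have -> : \bigcap_(i in [set` J]) (coin i @^-1` B i) =
    [set w | outcome w \in family Q].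
  apply/seteqP; split => w /= h.
    by apply/familyP => i; apply/implyP => /h; rewrite inE.
  by move=> i /= iJ; move/familyP/(_ i)/implyP: h => /(_ iJ); rewrite inE.
rewrite coinsE -(bigA_distr_big_dep Q coinweight); congr EFin.
rewrite [RHS]big_mkcond; apply: eq_bigr => i _; rewrite /Q.
by case: (i \in J) => //=; exact: sum_coinweight.
Qed.

Lemma coins_preimage i (B : set bool) :
  coins (coin i @^-1` B) = (\sum_(b | b \in B) coinweight i b)%:E.
Proof.
rewrite -(big_set1 *%R i (fun i => \sum_(b | b \in B) coinweight i b)).
rewrite -coins_cylinder; congr coins; apply/seteqP; split => w /= h.
  by move=> j /=; rewrite inE => /eqP ->.
by apply: h; rewrite /= inE.
Qed.

(** Every vector of probabilities is thus realised by a family against which a valid bound can be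
    tested. *)
Lemma coins_bernoulli :
  bernoulli_family (coins : probability nat R) q
    (fun i => coin i : {RV coins >-> bool}).
Proof.
split=> [J B _|i].
  rewrite [LHS](coins_cylinder J B) -prodEFin; apply: eq_bigr => i _.
  exact/esym/coins_preimage.
rewrite [LHS](coins_preimage i [set true]) (big_pred1 true) // => b.
by apply/idP/eqP; rewrite inE.
Qed.

End weights.

(** * Law of the number of successes *)

Section success_count.
Variables (d : measure_display) (Omega : measurableType d) (R : realType).
Variables (P : probability Omega R) (n : nat) (q : 'I_n -> R).
Variable T : 'I_n -> {RV P >-> bool}.
Hypothesis PT : bernoulli_family P q T.

Definition outcome_vector (w : Omega) : {ffun 'I_n -> bool} := [ffun i => T i w].

Lemma ntrue_le (v : {ffun 'I_n -> bool}) : (ntrue v <= n)%N.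
Proof.
rewrite -[leqRHS]card_ord -sum1_card.
by apply: leq_sum => i _; case: (v i).
Qed.

Lemma success_countE w :
  success_count P T w = ntrue (outcome_vector w) :> nat.
Proof.
rewrite /success_count /ntrue.
under [in RHS]eq_bigr do rewrite ffunE.
rewrite inordK // ltnS.
have := ntrue_le (outcome_vector w); rewrite /ntrue.
by under eq_bigr do rewrite ffunE.
Qed.

Lemma outcome_vector_preimage v : outcome_vector @^-1` [set v] =
  \bigcap_(i in [set` [set: 'I_n]%SET]) (T i @^-1` [set v i]).
Proof.
apply/seteqP; split => w /=.
  by move=> <- i _ /=; rewrite ffunE.
by move=> h; apply/ffunP => i; rewrite ffunE; apply: h; rewrite /= inE.
Qed.

Lemma measurable_outcome_vector (B : set {ffun 'I_n -> bool}) :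
  measurable (outcome_vector @^-1` B).
Proof.
have -> : outcome_vector @^-1` B = \bigcup_(v in B) outcome_vector @^-1` [set v].
  by apply/seteqP; split => w; [exists (outcome_vector w) | case=> v Bv /= ->].
apply: fin_bigcup_measurable => [|v _]; first exact: finite_finset.
rewrite outcome_vector_preimage; apply: fin_bigcap_measurable => [|i _].
  exact: finite_finset.
exact: measurable_funPTI.
Qed.

Lemma prob_outcome_vector v :
  P (outcome_vector @^-1` [set v]) = (weight q v)%:E.
Proof.
rewrite outcome_vector_preimage; have [indep PTq] := PT.
rewrite indep// /weight -prodEFin (eq_bigl xpredT) => [|i]; last by rewrite inE.
apply: eq_bigr => i _; rewrite /coinweight; case: (v i) => //.
have -> : T i @^-1` [set false] = ~` (T i @^-1` [set true]).
  by apply/seteqP; split => w /=; case: (T i w).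
rewrite probability_setC ?PTq ?EFinB//; exact: measurable_funPTI.
Qed.

Lemma prob_success_count_lt k :
  P [set w | (success_count P T w < k)%N] = (lowmass k (pgf q))%:E.
Proof.
have -> : [set w | (success_count P T w < k)%N] =
    \bigcup_(v in [set` [pred v | (ntrue v < k)%N]]) outcome_vector @^-1` [set v].
  apply/seteqP; split => w /=; rewrite success_countE.
    by move=> h; exists (outcome_vector w).
  by case=> v /= h ->.
rewrite measure_fin_bigcup; last first.
- by move=> v _; exact: measurable_outcome_vector.
- by move=> v v' _ _ [w [/= -> ->]].
- exact: finite_finset.
rewrite lowmass_pgf -sumEFin.
rewrite -(@bigfs _ _ _ _ (index_enum {ffun 'I_n -> bool})); last 2 first.
- exact: index_enum_uniq.
- by move=> v _; rewrite mem_index_enum.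
by apply: eq_bigr => v _; exact: prob_outcome_vector.
Qed.

Lemma measurable_success_count (B : set 'I_n.+1) :
  measurable [set w | B (success_count P T w)].
Proof.
have -> : [set w | B (success_count P T w)] =
    outcome_vector @^-1` [set v | B (inord (ntrue v))].
  by apply/seteqP; split => w /=; rewrite -success_countE inord_val.
exact: measurable_outcome_vector.
Qed.

End success_count.

(** * Largest monotone valid bounds *)

Section bounds.
Variables (R : realType) (n : nat) (alpha : R).
Implicit Types (q : 'I_n -> R) (x : R).

(* By [prob_success_count_lt], [lowmass k (pgf q)] is P_q(S < k): safe values
   are at most, sharp values at least, the infimum of the means of the vectors
   [q] with P_q(S >= k) > alpha. *)
Definition safe_bound k x := forall q, (forall i, 0 <= q i <= 1) ->
  mean q < x -> 1 - alpha <= lowmass k (pgf q).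

Definition sharp_bound k x := forall y, x < y ->
  exists q, [/\ forall i, 0 <= q i <= 1, mean q < y & lowmass k (pgf q) < 1 - alpha].

Lemma lowmassS_le k q : (forall i, 0 <= q i <= 1) ->
  lowmass k (pgf q) <= lowmass k.+1 (pgf q).
Proof.
move=> q01; rewrite !lowmass_pgf big_mkcond [leRHS]big_mkcond.
apply: ler_sum => v _; have [vk|_] := ltnP (ntrue v) k; first by rewrite ltnW.
by case: ifP => // _; exact: weight_ge0.
Qed.

Lemma monotone_boundP (qhat : 'I_n.+1 -> R) : monotone_bound qhat ->
  forall k l : 'I_n.+1, (k <= l)%N -> qhat k <= qhat l.
Proof.
move=> mono k [l ln] /= kl; move: l kl ln; apply: nat_ind => [|l IH].
  by rewrite leqn0 => /eqP k0 ln; rewrite (_ : k = Ordinal ln)//; exact: val_inj.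
rewrite leq_eqVlt => /predU1P[kl|kl] ln.
  by rewrite (_ : k = Ordinal ln)//; exact: val_inj.
by apply: le_trans (IH kl (ltnW ln)) _; exact: mono.
Qed.

(** If the value dropped from [k] to [k.+1], sharpness at [k.+1] would give a [q] with mean below
    [qhat k] and P(S < k+1) < 1 - alpha, whereas safety at [k] gives P(S < k) >= 1 - alpha. *)
Lemma safe_sharp_monotone (qhat : 'I_n.+1 -> R) :
  (forall k : 'I_n.+1, safe_bound k (qhat k)) ->
  (forall k : 'I_n.+1, sharp_bound k (qhat k)) ->
  monotone_bound qhat.
Proof.
move=> safe sharp k l lk; rewrite leNgt; apply/negP => /sharp[q [q01 qk]].
by rewrite ltNge lk (le_trans (safe k q q01 qk))// lowmassS_le.
Qed.

(** For the least [k] with [mean q < qhat k], the event S < k lies inside the validity event, and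
    safety at [k] bounds its probability. *)
Lemma safe_valid (qhat : 'I_n.+1 -> R) : 0 <= alpha ->
  (forall k : 'I_n.+1, safe_bound k (qhat k)) -> valid_bound alpha qhat.
Proof.
move=> alpha0 safe d Omega P q T q01 PT.
have mE (B : set 'I_n.+1) := measurable_success_count T B.
have [[k0 qk0]|no_k] := pselect (exists k, mean q < qhat k); last first.
  rewrite (_ : [set w | _] = setT); last first.
    apply/seteqP; split => // w _ /=; rewrite leNgt; apply/negP => h.
    by apply: no_k; exists (success_count P T w).
  by rewrite probability_setT lee_fin lerBlDr lerDl.
case: (@arg_minnP _ k0 (fun k => mean q < qhat k) (@nat_of_ord _) qk0) => k qk mink.
apply: (@le_trans _ _ (P [set w | (success_count P T w < k)%N])).
  by rewrite (prob_success_count_lt PT) lee_fin; exact: safe.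
apply: le_measure; rewrite ?inE.
- exact: (mE [set j : 'I_n.+1 | (j < k)%N]).
- exact: (mE [set j | qhat j <= mean q]).
by move=> w /=; rewrite ltnNge leNgt; apply: contra; exact: mink.
Qed.

(** If [qhat' k] exceeded [qhat k], a sharp witness [q] would have mean below [qhat' k]. By
    monotonicity the validity event of [qhat'] then lies in S < k, whose probability is too
    small. *)
Lemma sharp_largest (qhat qhat' : 'I_n.+1 -> R) :
  (forall k : 'I_n.+1, sharp_bound k (qhat k)) -> monotone_bound qhat' ->
  valid_bound alpha qhat' -> forall k, qhat' k <= qhat k.
Proof.
move=> sharp /monotone_boundP mono valid k.
rewrite leNgt; apply/negP => /sharp[q [q01 qk]]; rewrite ltNge => /negP; apply.
have PT := coins_bernoulli q01.
rewrite -lee_fin -(prob_success_count_lt PT).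
apply: le_trans (valid _ _ _ _ _ q01 PT) _.
have mE (B : set 'I_n.+1) := measurable_success_count
  (fun i => coin i : {RV coins q01 >-> bool}) B.
apply: le_measure; rewrite ?inE.
- exact: (mE [set j | qhat' j <= mean q]).
- exact: (mE [set j : 'I_n.+1 | (j < k)%N]).
move=> w /=; rewrite ltnNge => h; apply/negP => /mono.
by move/le_trans/(_ h); rewrite leNgt qk.
Qed.

Lemma bincdf_large N k (a : R) : (N < k)%N -> bincdf N k a = 1.
Proof.
elim: k => // k IH; rewrite ltnS leq_eqVlt => /predU1P[<-|Nk].
  exact: bincdf_full.
rewrite /bincdf big_ord_recr /= -/(bincdf N k a) IH//.
by rewrite /binpmf bin_small// !mul0r addr0.
Qed.

(** * Safety and sharpness of the explicit values *)

Hypothesis n_gt0 : (0 < n)%N.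
Hypothesis alpha01 : 0 <= alpha < 1.

Let n0 : 0 < n%:R :> R. Proof. by rewrite ltr0n. Qed.

(** The witness has [m] entries slightly above [y] and zeros elsewhere; strict decrease of [bincdf]
    pushes it below [1 - alpha]. *)
Lemma binomial_sharp d m (y : R) : (d < m <= n)%N -> 0 <= y <= 1 ->
  bincdf m d.+1 y = 1 - alpha -> sharp_bound d.+1 (m%:R * y / n%:R).
Proof.
move=> /andP[dm mn] /andP[y0 y1] yE z yz.
have m0 : 0 < m%:R :> R by rewrite ltr0n; lia.
(* At [y = 1] the distribution function is 0, while [1 - alpha] is positive. *)
have {}y1 : y < 1.
  rewrite lt_neqAle y1 andbT; apply/eqP => y1'.
  have := alpha01; rewrite -[alpha < 1]subr_gt0 -yE y1' bincdf1// ltxx andbF //.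
have {}yz : y < z * n%:R / m%:R.
  by rewrite ltr_pdivlMr// mulrC -ltr_pdivrMr.
pose t := Num.min 1 (z * n%:R / m%:R).
have yt : y < t by rewrite lt_min y1 yz.
have [t1 tz] : t <= 1 /\ t <= z * n%:R / m%:R by rewrite !ge_min !lexx orbT.
pose a := (y + t) / 2.
have [ya at'] : y < a /\ a < t by rewrite /a; lra.
pose q (i : 'I_n) := if (i < m)%N then a else 0.
have cardm : #|[pred i : 'I_n | (i < m)%N]| = m.
  transitivity (\sum_(i < n | (i < m)%N) 1)%N; first by rewrite -sum1_card.
  by rewrite -(big_ord_widen n (fun=> 1%N) mn) sum_nat_const card_ord muln1.
exists q; split.
- by move=> i; rewrite /q; case: ifP => _; lra.
- rewrite /mean /q -big_mkcond /= sumr_const cardm mulrC ltr_pdivrMr//.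
  have : a < z * n%:R / m%:R by lra.
  by rewrite ltr_pdivlMr// -[a *+ m]mulr_natr.
- have -> : pgf q = bpoly a ^+ m.
    rewrite /pgf -[in RHS]cardm -prodr_const [RHS]big_mkcond; apply: eq_bigr => i _.
    by rewrite /q inE; case: ifP => //; rewrite bpoly0.
  rewrite lowmass_bpolyX -yE; apply: bincdf_lt => //; rewrite in_itv/=; lra.
Qed.

(** Here [s] counts the zero entries. By reflection, one minus the inverse Beta value is the common
    probability [y] of the other [n - s] trials. *)
Lemma Sn_spec d s : (d < n)%N -> (s <= n - d - 1)%N ->
  exists y, [/\ 0 <= y <= 1, bincdf (n - s) d.+1 y = 1 - alpha &
    1 - Sn n (n - d - 1) alpha s = (n - s)%:R * y / n%:R].
Proof.
move=> dn sn; rewrite /Sn.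
have -> : (n - (n - d - 1) = d.+1)%N by lia.
rewrite addn1; set x := inc_beta_inv _ _ _.
have alphaC01 : 0 <= 1 - alpha <= 1 by have := alpha01; lra.
have [] := inc_beta_invP (n - d - 1 - s) d alphaC01.
rewrite -/x subKr => x01 xE.
exists (1 - x); split; first lra.
  have -> : (n - s = (n - d - 1 - s + d).+1)%N by lia.
  rewrite bincdf_reflect; last by lia.
  by rewrite subKr -xE; congr (1 - bincdf _ _ _); lia.
rewrite natrB; last by lia.
by field; rewrite gt_eqF.
Qed.

Lemma Snmax_ge d s : (s <= n - d - 1)%N ->
  Sn n (n - d - 1) alpha s <= Snmax n (n - d - 1) alpha.
Proof.
move=> sc; rewrite /Snmax big_mkord.
exact: (le_bigmax _ (fun s : 'I__ => Sn n (n - d - 1) alpha s)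
  (Ordinal (sc : (s < _.+1)%N))).
Qed.

Lemma Snmax_attained d : exists2 s, (s <= n - d - 1)%N &
  Snmax n (n - d - 1) alpha = Sn n (n - d - 1) alpha s.
Proof.
rewrite /Snmax big_nat_cond.
elim/big_rec: _ => [|i x /andP[/andP[_ ic] _] [s sc ->]]; first by exists 0%N.
by rewrite maxEle; case: ifP => _; [exists s | exists i].
Qed.

Lemma mean_sum q : \sum_i q i = n%:R * mean q.
Proof. by rewrite /mean mulrA divff ?mul1r// gt_eqF. Qed.

(** The extremal vector has [m] equal entries: if [m <= d] the tail is trivial, otherwise the term
    [s = n - m] of the maximum controls it. *)
Lemma Snmax_safe d : (d < n)%N -> safe_bound d.+1 (1 - Snmax n (n - d - 1) alpha).
Proof.
move=> dn q q01 qlt.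
have qlts s : (s <= n - d - 1)%N -> mean q < 1 - Sn n (n - d - 1) alpha s.
  by move=> sc; apply: lt_le_trans qlt _; rewrite lerD2l lerN2 Snmax_ge.
have [y [y01 _ yE]] := Sn_spec dn (leqnn _).
(* The last term, [s = n - d - 1], leaves [d.+1] trials of probability at most 1. *)
have sum_lt : \sum_i q i < d.+1%:R.
  have := qlts _ (leqnn _); rewrite yE ltr_pdivlMr// mulrC -mean_sum.
  have -> : (n - (n - d - 1) = d.+1)%N by lia.
  by move=> /lt_le_trans; apply; rewrite ler_piMr//; lra.
have [L1|[m [a [mn a01 ma le_a _]]]] := hoeffding_bound q01 sum_lt.
  by apply: le_trans L1; have := alpha01; lra.
apply: le_trans le_a; have [md|dm] := ltnP m d.+1.
  by rewrite bincdf_large//; have := alpha01; lra.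
have sc : (n - m <= n - d - 1)%N by lia.
have [z [z01 zE zS]] := Sn_spec dn sc.
rewrite -zE subKn//; apply: bincdf_le; rewrite ?in_itv//=.
have := qlts _ sc; rewrite zS subKn// ltr_pdivlMr// mulrC -mean_sum -ma.
by rewrite ltr_pM2l ?ltr0n; [exact: ltW | lia].
Qed.

Lemma Snmax_sharp d : (d < n)%N -> sharp_bound d.+1 (1 - Snmax n (n - d - 1) alpha).
Proof.
move=> dn; have [s sc ->] := Snmax_attained d.
have [y [y01 yE ->]] := Sn_spec dn sc.
by apply: binomial_sharp => //; lia.
Qed.

Lemma inc_beta_inv_spec d : (d < n)%N ->
  let y := inc_beta_inv (d + 1)%:R (n - d)%:R alpha in
  0 <= y <= 1 /\ bincdf n d.+1 y = 1 - alpha.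
Proof.
move=> dn; have -> : (n - d = (n - d.+1).+1)%N by lia.
have alpha01' : 0 <= alpha <= 1 by have := alpha01; lra.
have [] := inc_beta_invP d (n - d.+1) alpha01'.
by rewrite addn1; have -> : ((d + (n - d.+1)).+1 = n)%N by lia.
Qed.

Lemma inc_beta_inv_sharp d : (d < n)%N ->
  sharp_bound d.+1 (inc_beta_inv (d + 1)%:R (n - d)%:R alpha).
Proof.
move=> dn; have [y01 yE] := inc_beta_inv_spec dn; move: y01 yE.
set y := inc_beta_inv _ _ _ => y01 yE.
have := @binomial_sharp d n y _ y01 yE; rewrite [n%:R * _]mulrC mulfK ?gt_eqF//.
by apply; rewrite dn /=.
Qed.

(** The condition on [alpha] says that the inverse Beta value is at most [d%:R / n%:R]. The sum is
    then below [d], where the extremal vector has all its entries equal. *)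
Lemma inc_beta_inv_safe d : (d < n)%N -> alpha <= alpha_dagger R d n ->
  safe_bound d.+1 (inc_beta_inv (d + 1)%:R (n - d)%:R alpha).
Proof.
move=> dn; have [y01 yE] := inc_beta_inv_spec dn; move: y01 yE.
set y := inc_beta_inv _ _ _ => y01 yE le_alpha.
have dn1 : 0 <= (d%:R / n%:R : R) <= 1.
  by rewrite divr_ge0//= ler_pdivrMr// mul1r ler_nat ltnW.
have le_y : y <= d%:R / n%:R.
  rewrite leNgt; apply/negP => lt_y; move: le_alpha; rewrite /alpha_dagger.
  have -> : (n - d = (n - d.+1).+1)%N by lia.
  rewrite addn1 inc_beta_bincdf//; have -> : ((d + (n - d.+1)).+1 = n)%N by lia.
  have : bincdf n d.+1 y < bincdf n d.+1 (d%:R / n%:R).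
    by apply: bincdf_lt; rewrite ?in_itv.
  by rewrite yE; lra.
move=> q q01 qy.
have sum_lt : \sum_i q i < d%:R.
  by rewrite mean_sum mulrC -ltr_pdivlMr//; exact: lt_le_trans le_y.
have sum_ltS : \sum_i q i < d.+1%:R by rewrite -natr1; lra.
have [L1|[m [a [mn a01 ma le_a mE]]]] := hoeffding_bound q01 sum_ltS.
  by apply: le_trans L1; have := alpha01; lra.
apply: le_trans le_a; rewrite (mE (ltW sum_lt)) in ma *.
move: ma a01; rewrite mean_sum => /(mulfI (lt0r_neq0 n0)) -> mean01.
rewrite -yE; apply: bincdf_le; rewrite ?in_itv//=; last exact: ltW.
Qed.

Lemma qhatf_safe_sharp (k : 'I_n.+1) :
  safe_bound k (qhatf alpha k) /\ sharp_bound k (qhatf alpha k).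
Proof.
rewrite /qhatf; case: k => -[|d] dn /=.
  (* At [k = 0] the value is 0: no mean is negative, and the zero vector is a sharp witness since
     P(S < 0) = 0. *)
  split=> [q q01|y y0].
    rewrite ltNge mulr_ge0 ?invr_ge0 ?ler0n ?sumr_ge0// => i _.
    by have /andP[] := q01 i.
  exists (fun=> 0); split; first by move=> i; rewrite lexx ler01.
    by rewrite /mean big1// mulr0.
  by rewrite /lowmass big_ord0 subr_gt0; have /andP[] := alpha01.
have {}dn : (d < n)%N by [].
have -> : (d.+1 - 1)%N = d by rewrite subn1.
case: ltP => [_|le_alpha].
  by split; [exact: Snmax_safe | exact: Snmax_sharp].
by split; [exact: inc_beta_inv_safe | exact: inc_beta_inv_sharp].
Qed.

End bounds.

Theorem proposition2 (R : realType) (n : nat) (alpha : R)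
  (hn : (1 <= n)%N) (halpha : 0 <= alpha < 1) :
  monotone_bound (@qhatf R alpha n) /\
  valid_bound alpha (@qhatf R alpha n) /\
  (forall qhat' : 'I_n.+1 -> R,
     monotone_bound qhat' -> valid_bound alpha qhat' ->
     forall k : 'I_n.+1, qhat' k <= qhatf alpha k).
Proof.
have safe k := (qhatf_safe_sharp hn halpha k).1.
have sharp k := (qhatf_safe_sharp hn halpha k).2.
split; first exact: safe_sharp_monotone safe sharp.
split; first by apply: safe_valid safe; case/andP: halpha.
move=> qhat' mono valid; exact: sharp_largest sharp mono valid.
Qed.
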